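(* For $t,b\in[0,1]$, the map $T_t\otimes\Pi_{\lambda_b}:\mathcal{M}_4\to\mathcal{M}_4$ is positive and not decomposable if and only if $t\le\frac1{2b}$ and $3<2b+t+2bt$. (Moreover, $T_t\otimes\Pi_{\lambda_b}$ is positive if and only if $t\le\frac1{2b}$.)
   Context: $T_t(X)=(1-t)\mathrm{Tr}(X)\frac{I_2}{2}+tX$ on $\mathcal{M}_2$. For $b\in[0,1]$, $\Pi_{\lambda_b}(X)=\mathrm{Tr}(X)\frac{I_2}2+\frac b2\big(\mathrm{Tr}(X\sigma_2)\sigma_2+\mathrm{Tr}(X\sigma_4)\sigma_4\big)$ with $\sigma_2=\begin{pmatrix}0&1\\1&0\end{pmatrix}$, $\sigma_4=\begin{pmatrix}0&-i\\i&0\end{pmatrix}$ (the Pauli diagonal map with parameter vector $(1,b,0,b)$). Decomposable means $T+\vartheta\circ S$ with $T,S$ completely positive, $\vartheta$ the transpose. *)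

(* Defs.v *)
From HB Require Import structures.
From mathcomp Require Import all_boot all_order all_algebra.
From mathcomp Require Import complex mxtens.
From mathcomp Require Import reals.
Set Implicit Arguments. Unset Strict Implicit. Unset Printing Implicit Defensive.
Import Order.TTheory GRing.Theory Num.Theory.
Local Open Scope ring_scope.
Local Open Scope complex_scope.

Section Defs.
Variable R : realType.
Local Notation C := R[i].

Definition adjv n (v : 'cV[C]_n) : 'rV[C]_n := (map_mx Num.conj v)^T.

(* positive semidefinite: v^* A v >= 0 for all v (order of the numClosedField C,
   i.e. real and nonnegative) *)
Definition psd n (A : 'M[C]_n) : Prop :=
  forall v : 'cV[C]_n, 0 <= (adjv v *m A *m v) 0 0.

Definition linmap n m (Phi : 'M[C]_n -> 'M[C]_m) : Prop :=
  forall (a : C) (X Y : 'M[C]_n), Phi (a *: X + Y) = a *: Phi X + Phi Y.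

Definition positive_map n m (Phi : 'M[C]_n -> 'M[C]_m) : Prop :=
  forall A, psd A -> psd (Phi A).

Definition blockmx p n (X : 'M[C]_(p * n)) (i j : 'I_p) : 'M[C]_n :=
  \matrix_(a, b) X (mxtens_index (i, a)) (mxtens_index (j, b)).

(* tensor product of linear maps Phi1 (x) Phi2 : M_(p1*n) -> M_(p2*m),
   the linear extension of A (x) B |-> Phi1 A (x) Phi2 B *)
Definition tensmap p1 p2 n m (Phi1 : 'M[C]_p1 -> 'M[C]_p2)
    (Phi2 : 'M[C]_n -> 'M[C]_m) (X : 'M[C]_(p1 * n)) : 'M[C]_(p2 * m) :=
  \sum_(i < p1) \sum_(j < p1) tensmx (Phi1 (delta_mx i j)) (Phi2 (blockmx X i j)).

Definition completely_positive n m (Phi : 'M[C]_n -> 'M[C]_m) : Prop :=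
  forall k : nat, positive_map (tensmap (@id 'M[C]_k) Phi).

Definition decomposable n m (Phi : 'M[C]_n -> 'M[C]_m) : Prop :=
  exists T S : 'M[C]_n -> 'M[C]_m,
    [/\ linmap T, linmap S, completely_positive T, completely_positive S &
        forall X, Phi X = T X + (S X)^T].

Definition sigma2 : 'M[C]_2 := delta_mx 0 1 + delta_mx 1 0.
Definition sigma4 : 'M[C]_2 := (- 'i) *: delta_mx 0 1 + 'i *: delta_mx 1 0.

Definition Tmap (t : R) (X : 'M[C]_2) : 'M[C]_2 :=
  ((1 - t)%:C * \tr X / 2) *: 1%:M + t%:C *: X.

Definition Pimap (b : R) (X : 'M[C]_2) : 'M[C]_2 :=
  (\tr X / 2) *: 1%:M
  + (b%:C / 2) *: (\tr (X *m sigma2) *: sigma2 + \tr (X *m sigma4) *: sigma4).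

Definition TPi (t b : R) : 'M[C]_(2 * 2) -> 'M[C]_(2 * 2) :=
  tensmap (Tmap t) (Pimap b).

End Defs.

(* Main.v *)
Require Import Defs.
From HB Require Import structures.
From mathcomp Require Import all_boot all_order all_algebra.
From mathcomp Require Import complex mxtens reals.
From mathcomp Require Import ring lra spectral.
Import Order.TTheory GRing.Theory Num.Theory.
Local Open Scope ring_scope.

(** Positivity.  By the spectral theorem it is enough to look at rank-one
inputs.  Writing the input vector as (u, v) and the test vector as (x, y), with
blocks indexed by the second tensor factor, the quadratic form depends on the
inner products of u, v with x, y, and the identity
[<x,u><y,v> - <x,v><y,u> = det(x,y)^* det(u,v)] together with Lagrange's
identity bounds [|<x,u><v,y>|] by what the form can absorb when 2bt <= 1.
Maximally entangled input and test vectors show that the bound is sharp.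

Decomposability.  When 2b + t + 2bt <= 3, an explicit decomposition is found in
the cone spanned by products of covariant qubit maps; its second summand uses
that X |-> tr(X) 1 - X and X |-> tr(X) 1 + X become completely positive after
composition with the transpose.  Conversely, pairing the Choi matrix of the map
with a suitable positive matrix W whose partial transpose is positive gives
6 (3 - 2b - t - 2bt), which must be nonnegative for a decomposable map. *)

Set Implicit Arguments.
Unset Strict Implicit.
Unset Printing Implicit Defensive.

(** * Sums over qubit indices and tensor-product indices *)

Lemma ord2P (i : 'I_2) : i = 0 \/ i = 1.
Proof. by case: i => [[|[|]]] // H; [left|right]; apply: val_inj. Qed.

Lemma sum_ord2 (V : nmodType) (F : 'I_2 -> V) : \sum_i F i = F 0 + F 1.
Proof.
rewrite big_ord_recl big_ord1; congr (_ + F _); exact: val_inj.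
Qed.

Lemma sum_mxtens (V : nmodType) m n (F : 'I_(m * n) -> V) :
  \sum_i F i = \sum_i \sum_j F (mxtens_index (i, j)).
Proof.
rewrite pair_big /= (reindex (@mxtens_index m n)) /=.
  by apply: eq_bigr => -[].
by exists (@mxtens_unindex m n) => i; rewrite (mxtens_indexK, mxtens_unindexK).
Qed.

Lemma mxtens_index_eq m n (i j : 'I_m) (k l : 'I_n) :
  (mxtens_index (i, k) == mxtens_index (j, l)) = (i == j) && (k == l).
Proof. by rewrite (can_eq (@mxtens_indexK m n)). Qed.

(** * The inequality behind positivity *)

Section PositivityInequality.
Variable K : numClosedFieldType.

(** The real part of [z] is at least minus its modulus. The order of a [numClosedFieldType] is only
    partial, so [z + z^*] is first shown to be real. *)
Lemma addcJ_ge (z : K) : 0 <= z + z^* + 2 * `|z|.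
Proof.
have zr : z + z^* \is Num.real by apply/CrealP; rewrite rmorphD /= conjCK addrC.
have : `|z + z^*| <= 2 * `|z|.
  by rewrite (le_trans (ler_normD _ _)) // norm_conjC mulr_natl mulr2n.
rewrite -normrN -subr_ge0 => h.
have zn : - (z + z^*) \is Num.real by rewrite rpredN.
have := real_ler_norm zn; rewrite -subr_ge0 => h'.
by have := addr_ge0 h h'; congr (0 <= _); ring.
Qed.

Lemma AM_GM_norm (y z : K) : 0 <= y * y^* + z * z^* - 2 * (`|y| * `|z|).
Proof.
have : 0 <= (`|y| - `|z|) ^+ 2.
  by apply: real_exprn_even_ge0 => //; rewrite rpredB ?normr_real.
by rewrite -!normCK; congr (0 <= _); ring.
Qed.

(** Cauchy-Schwarz followed by AM-GM. Comparing squares avoids roots: the difference consists of two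
    AM-GM defects and the Lagrange defect [(d1 * e2 - e1 * d2) ^+ 2]. *)
Lemma Cauchy_AM_GM (a b c d d1 d2 e1 e2 : K) :
  0 <= a -> 0 <= b -> 0 <= c -> 0 <= d ->
  0 <= d1 -> 0 <= d2 -> 0 <= e1 -> 0 <= e2 ->
  d1 ^+ 2 + e1 ^+ 2 = a * b -> d2 ^+ 2 + e2 ^+ 2 = c * d ->
  4 * (d1 * d2 + e1 * e2) <= (a + b) * (c + d).
Proof.
move=> a0 b0 c0 d0 d10 d20 e10 e20 hab hcd.
have sq (x y : K) : 0 <= x -> 0 <= y -> 0 <= (x - y) ^+ 2.
  by move=> x0 y0; apply: real_exprn_even_ge0 => //; rewrite rpredB ?ger0_real.
rewrite -ler_sqr ?nnegrE ?mulr_ge0 ?addr_ge0 ?mulr_ge0 // -subr_ge0.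
have -> : ((a + b) * (c + d)) ^+ 2 - (4 * (d1 * d2 + e1 * e2)) ^+ 2 =
    (a + b) ^+ 2 * (c - d) ^+ 2 + 4 * (c * d) * (a - b) ^+ 2 +
    16 * (d1 * e2 - e1 * d2) ^+ 2.
  transitivity ((a + b) ^+ 2 * (c - d) ^+ 2 + 4 * (c * d) * (a - b) ^+ 2 +
    16 * ((a * b) * (c * d) - (d1 * d2 + e1 * e2) ^+ 2)); first ring.
  rewrite -hab -hcd; ring.
apply: addr_ge0; first apply: addr_ge0.
- by rewrite mulr_ge0 ?sq ?exprn_ge0 ?addr_ge0.
- by rewrite mulr_ge0 ?sq // mulr_ge0 ?mulr_ge0.
- by rewrite mulr_ge0 ?sq // mulr_ge0.
Qed.

Variables t b : K.
Hypotheses (t0 : 0 <= t) (t1 : t <= 1) (b0 : 0 <= b) (b1 : b <= 1).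
Hypothesis tb : 2 * b * t <= 1.

(** [P] has total coefficient [t * (1 - 2 * b)]. It is kept when [2 * b <= 1]; otherwise it is
    traded for its bound [Q + (D - a)], which leaves [D - a] with weight [1 - 2 * b * t],
    nonnegative by [tb]. *)
Lemma product_form_ge0 (D a P Q : K) :
  0 <= a -> 0 <= P -> 0 <= Q -> 0 <= D - a -> 0 <= Q + (D - a) - P ->
  0 <= (1 - t) * D - b * (1 - t) * a + t * (P + Q) - 2 * t * b * P.
Proof.
move=> a0 P0 Q0 Da QDP.
have t1' : 0 <= 1 - t by rewrite subr_ge0.
have b1' : 0 <= 1 - b by rewrite subr_ge0.
have tb' : 0 <= 1 - 2 * b * t by rewrite subr_ge0.
have : (2 * b <= 1) || (1 <= 2 * b).
  by rewrite real_leVge // ger0_real // mulr_ge0.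
case/orP => hb.
  have hb' : 0 <= 1 - 2 * b by rewrite subr_ge0.
  have -> : (1 - t) * D - b * (1 - t) * a + t * (P + Q) - 2 * t * b * P =
     (1 - t) * (D - a) + (1 - t) * ((1 - b) * a) + t * ((1 - 2 * b) * P) + t * Q
     by ring.
  by rewrite !addr_ge0 // !mulr_ge0.
have hb' : 0 <= 2 * b - 1 by rewrite subr_ge0.
have -> : (1 - t) * D - b * (1 - t) * a + t * (P + Q) - 2 * t * b * P =
   t * ((2 * b - 1) * (Q + (D - a) - P)) + (1 - 2 * b * t) * (D - a) +
   (1 - t) * ((1 - b) * a) + 2 * (t * ((1 - b) * Q)) by ring.
by rewrite !addr_ge0 // !mulr_ge0.
Qed.

Lemma TPi_form_ge0 (u1 u2 v1 v2 x1 x2 y1 y2 : K) :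
  let p := x1^* * u1 + x2^* * u2 in
  let q := v1^* * y1 + v2^* * y2 in
  let r := y1^* * u1 + y2^* * u2 in
  let s := x1^* * v1 + x2^* * v2 in
  let A := (v1^* * u1 + v2^* * u2) * (x1^* * y1 + x2^* * y2) in
  let N := u1 * u1^* + u2 * u2^* + (v1 * v1^* + v2 * v2^*) in
  let M := x1 * x1^* + x2 * x2^* + (y1 * y1^* + y2 * y2^*) in
  is_true (0 <= (1 - t) * (N * M) + 2 * (b * (1 - t)) * (A + A^*)
       + 2 * t * (p * p^* + q * q^* + r * r^* + s * s^*)
       + 4 * (t * b) * (p * q + (p * q)^*)).
Proof.
move=> p q r s A N M.
(* [d1] is det(u,v), [d2] the conjugate of det(x,y), and [e1], [e2] are <v,u> and <x,y>. Lagrange's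
   identity for each pair gives the hypotheses of [Cauchy_AM_GM]. *)
pose d1 := u1 * v2 - u2 * v1; pose d2 := x1^* * y2^* - x2^* * y1^*.
pose e1 := v1^* * u1 + v2^* * u2; pose e2 := x1^* * y1 + x2^* * y2.
have n0 (z : K) : 0 <= z * z^* by rewrite mul_conjC_ge0.
have cD (x y : K) : (x + y)^* = x^* + y^* by exact: rmorphD.
have cM (x y : K) : (x * y)^* = x^* * y^* by exact: rmorphM.
have cN (x : K) : (- x)^* = - x^* by exact: rmorphN.
have cr := (cD, cN, cM, @conjCK K).
have cauchy : 4 * (`|d1| * `|d2| + `|e1| * `|e2|) <= N * M.
  apply: Cauchy_AM_GM; rewrite ?addr_ge0 //.
    by rewrite !normCK /d1 /e1 !cr; ring.
  by rewrite !normCK /d2 /e2 !cr; ring.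
(* Conjugating [q] keeps its modulus, and [p * q^* = r * s + d1 * d2]. *)
have det : `|p| * `|q| <= `|r| * `|s| + `|d1| * `|d2|.
  have -> : `|p| * `|q| = `|r * s + d1 * d2|.
    rewrite -[`|q|]norm_conjC -normrM /p /q /r /s /d1 /d2 !cr.
    by congr `|_|; ring.
  by rewrite -!normrM ler_normD.
have Aa : `|A| = `|e1| * `|e2| by rewrite normrM.
have t1' : 0 <= 1 - t by rewrite subr_ge0.
have fP : 0 <= N * M - 4 * `|A|.
  rewrite subr_ge0 (le_trans _ cauchy) // Aa ler_wpM2l // lerDr mulr_ge0 //.
have fQ : 0 <= 4 * (`|r| * `|s|) + (N * M - 4 * `|A|) - 4 * (`|p| * `|q|).
  have h1 : 0 <= N * M - 4 * (`|d1| * `|d2| + `|e1| * `|e2|).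
    by rewrite subr_ge0.
  have h2 : 0 <= 4 * (`|r| * `|s| + `|d1| * `|d2| - `|p| * `|q|).
    by rewrite mulr_ge0 // subr_ge0.
  by have := addr_ge0 h1 h2; rewrite Aa; congr (0 <= _); ring.
have m0 (x y : K) : 0 <= 4 * (`|x| * `|y|) by rewrite !mulr_ge0.
have a4 : 0 <= 4 * `|A| by rewrite mulr_ge0.
have main := product_form_ge0 a4 (m0 p q) (m0 r s) fP fQ.
have hA := addcJ_ge A; have hp := addcJ_ge (p * q).
have g1 := AM_GM_norm p q; have g2 := AM_GM_norm r s.
(* All phases are split off into terms that are nonnegative by [addcJ_ge] and [AM_GM_norm]; the
   first summand involves moduli only and is settled by [product_form_ge0]. *)
have -> : (1 - t) * (N * M) + 2 * (b * (1 - t)) * (A + A^*)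
       + 2 * t * (p * p^* + q * q^* + r * r^* + s * s^*)
       + 4 * (t * b) * (p * q + (p * q)^*) =
  ((1 - t) * (N * M) - b * (1 - t) * (4 * `|A|) + t * (4 * (`|p| * `|q|)
     + 4 * (`|r| * `|s|)) - 2 * t * b * (4 * (`|p| * `|q|)))
  + 2 * (b * ((1 - t) * (A + A^* + 2 * `|A|)))
  + 2 * (t * (p * p^* + q * q^* - 2 * (`|p| * `|q|)))
  + 2 * (t * (r * r^* + s * s^* - 2 * (`|r| * `|s|)))
  + 4 * (t * (b * (p * q + (p * q)^* + 2 * `|p * q|))).
  by rewrite (normrM p q); ring.
apply: addr_ge0; last by rewrite !mulr_ge0.
do 3?[apply: addr_ge0; last by rewrite !mulr_ge0].
exact: main.
Qed.

End PositivityInequality.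

(** * The quadratic form of the map in coordinates *)

Lemma sum4_ord2 (K : comPzRingType) (F : 'I_2 -> 'I_2 -> 'I_2 -> 'I_2 -> K) :
  \sum_i \sum_a \sum_j \sum_c F i a j c =
  F 0 0 0 0 + F 0 0 0 1 + F 0 0 1 0 + F 0 0 1 1 +
  (F 0 1 0 0 + F 0 1 0 1 + F 0 1 1 0 + F 0 1 1 1) +
  (F 1 0 0 0 + F 1 0 0 1 + F 1 0 1 0 + F 1 0 1 1) +
  (F 1 1 0 0 + F 1 1 0 1 + F 1 1 1 0 + F 1 1 1 1).
Proof. by rewrite !sum_ord2; ring. Qed.

(** The vectors u, v are the columns [f _ 0], [f _ 1], and x, y those of [g]; [G i j] holds the
    entries of [Pimap] on block (i,j) of a rank-one input. The factor 4 clears the two halves.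
    Working in an abstract field leaves a plain [field] identity. *)
Lemma TPi_form_algebra (K : numClosedFieldType) (t b : K) (f g : 'I_2 -> 'I_2 -> K) :
  let G i j (a c : 'I_2) :=
    if a == c then (f i 0 * (f j 0)^* + f i 1 * (f j 1)^*) / 2
    else b * (f i a * (f j c)^*) in
  let p := (g 0 0)^* * f 0 0 + (g 1 0)^* * f 1 0 in
  let q := (f 0 1)^* * g 0 1 + (f 1 1)^* * g 1 1 in
  let r := (g 0 1)^* * f 0 0 + (g 1 1)^* * f 1 0 in
  let s := (g 0 0)^* * f 0 1 + (g 1 0)^* * f 1 1 in
  let A := ((f 0 1)^* * f 0 0 + (f 1 1)^* * f 1 0) *
    ((g 0 0)^* * g 0 1 + (g 1 0)^* * g 1 1) in
  let N := f 0 0 * (f 0 0)^* + f 1 0 * (f 1 0)^* +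
    (f 0 1 * (f 0 1)^* + f 1 1 * (f 1 1)^*) in
  let M := g 0 0 * (g 0 0)^* + g 1 0 * (g 1 0)^* +
    (g 0 1 * (g 0 1)^* + g 1 1 * (g 1 1)^*) in
  4 * (\sum_i \sum_a \sum_j \sum_c (g i a)^* *
     ((1 - t) / 2 * (i == j)%:R * (G 0 0 a c + G 1 1 a c) + t * G i j a c) * g j c) =
  (1 - t) * (N * M) + 2 * (b * (1 - t)) * (A + A^*)
       + 2 * t * (p * p^* + q * q^* + r * r^* + s * s^*)
       + 4 * (t * b) * (p * q + (p * q)^*).
Proof.
have cD (x y : K) : (x + y)^* = x^* + y^* by exact: rmorphD.
have cM (x y : K) : (x * y)^* = x^* * y^* by exact: rmorphM.
move=> G p q r s A N M; rewrite sum4_ord2.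
rewrite /G /p /q /r /s /A /N /M !(cD, cM, @conjCK K) {cD cM G p q r s A N M} /=.
by field.
Qed.

Section TensorPauliMap.
Variable R : realType.
Local Notation C := R[i].
Local Notation "z %:C" := (real_complex R z) : ring_scope.

(** * Completely positive maps *)

Definition adjmx m n (K : 'M[C]_(m, n)) : 'M[C]_(n, m) := (map_mx Num.conj K)^T.

Lemma adjmxE m n (K : 'M[C]_(m, n)) i j : adjmx K i j = (K j i)^*.
Proof. by rewrite !mxE. Qed.

Lemma adjmxK m n : cancel (@adjmx m n) (@adjmx n m).
Proof. by move=> K; apply/matrixP => i j; rewrite !mxE conjCK. Qed.

Lemma adjmx_mul m n p (K : 'M[C]_(m, n)) (L : 'M[C]_(n, p)) :
  adjmx (K *m L) = adjmx L *m adjmx K.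
Proof. by rewrite /adjmx map_mxM trmx_mul. Qed.

Lemma psdD n (A B : 'M[C]_n) : psd A -> psd B -> psd (A + B).
Proof.
move=> pA pB v; rewrite mulmxDr mulmxDl mxE; exact: addr_ge0 (pA v) (pB v).
Qed.

Lemma psdZ n (c : C) (A : 'M[C]_n) : 0 <= c -> psd A -> psd (c *: A).
Proof.
by move=> c0 pA v; rewrite -scalemxAr -scalemxAl mxE mulr_ge0.
Qed.

Lemma psd0 n : psd (0 : 'M[C]_n).
Proof. by move=> v; rewrite mulmx0 mul0mx mxE. Qed.

Lemma psd_sum n I (r : seq I) (F : I -> 'M[C]_n) :
  (forall i, psd (F i)) -> psd (\sum_(i <- r) F i).
Proof. by move=> pF; elim/big_ind: _ => //; [exact: psd0|exact: psdD]. Qed.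

Lemma psd_conj m n (K : 'M[C]_(m, n)) (A : 'M[C]_n) :
  psd A -> psd (K *m A *m adjmx K).
Proof.
move=> pA v; have := pA (adjmx K *m v).
by rewrite [adjv _](adjmx_mul _ v) adjmxK !mulmxA.
Qed.

Lemma psd_rank1 n (v : 'cV[C]_n) : psd (v *m adjv v).
Proof.
move=> w; rewrite mulmxA -mulmxA mxE big_ord1.
have -> : (adjv v *m w) 0 0 = ((adjv w *m v) 0 0)^*.
  rewrite -[LHS]conjCK; congr (_^*).
  by rewrite -adjmxE [adjmx _]adjmx_mul [adjmx (adjv _)]adjmxK.
exact: mul_conjC_ge0.
Qed.

Lemma tensmapE p1 p2 n m (A : 'M[C]_p1 -> 'M[C]_p2) (B : 'M[C]_n -> 'M[C]_m)
    X i j a b :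
  tensmap A B X (mxtens_index (i, a)) (mxtens_index (j, b)) =
  \sum_k \sum_l A (delta_mx k l) i j * B (blockmx X k l) a b.
Proof.
rewrite /tensmap summxE; apply: eq_bigr => k _; rewrite summxE.
by apply: eq_bigr => l _; rewrite tensmxE.
Qed.

Lemma tensmap_idE k n m (B : 'M[C]_n -> 'M[C]_m) (X : 'M[C]_(k * n)) i j a b :
  tensmap id B X (mxtens_index (i, a)) (mxtens_index (j, b)) =
  B (blockmx X i j) a b.
Proof.
rewrite tensmapE (bigD1 i) //= (bigD1 j) //= mxE !eqxx mul1r.
rewrite big1 ?addr0 => [|l nl]; last by rewrite mxE eqxx eq_sym (negPf nl) mul0r.
rewrite big1 ?addr0 // => k' nk; rewrite big1 // => l _.
by rewrite mxE eq_sym (negPf nk) mul0r.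
Qed.

Lemma mxtens_matrixP p n q m (A B : 'M[C]_(p * n, q * m)) :
  (forall i a j b, A (mxtens_index (i, a)) (mxtens_index (j, b)) =
                   B (mxtens_index (i, a)) (mxtens_index (j, b))) -> A = B.
Proof.
move=> AB; apply/matrixP => x y.
by case: (mxtens_indexP x) => i a; case: (mxtens_indexP y).
Qed.

Lemma mxtens_form m1 n1 m2 n2 p1 q1 (K : 'M[C]_(m1 * n1, m2 * n2))
   (X : 'M[C]_(m2 * n2)) (L : 'M[C]_(m2 * n2, p1 * q1)) i a j b :
  (K *m X *m L) (mxtens_index (i, a)) (mxtens_index (j, b)) =
  \sum_k \sum_l \sum_c \sum_d K (mxtens_index (i, a)) (mxtens_index (k, c)) *
     blockmx X k l c d * L (mxtens_index (l, d)) (mxtens_index (j, b)).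
Proof.
rewrite mxE sum_mxtens [RHS]exchange_big /=; apply: eq_bigr => l _.
under [RHS]eq_bigr do rewrite exchange_big.
rewrite [RHS]exchange_big; apply: eq_bigr => d _ /=.
rewrite mxE sum_mxtens mulr_suml; apply: eq_bigr => k _.
by rewrite mulr_suml; apply: eq_bigr => c _; rewrite mxE.
Qed.

Lemma tensmap_conj m1 n1 m2 n2 (K : 'M[C]_(m1, n1)) (L : 'M[C]_(m2, n2)) X :
  tensmap (fun Y => K *m Y *m adjmx K) (fun Y => L *m Y *m adjmx L) X =
  tensmx K L *m X *m adjmx (tensmx K L).
Proof.
apply: mxtens_matrixP => i a j b; rewrite tensmapE mxtens_form.
apply: eq_bigr => k _; apply: eq_bigr => l _.
have -> : (K *m delta_mx k l *m adjmx K) i j = K i k * (K j l)^*.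
  rewrite mxE (bigD1 l) //= big1 ?addr0 => [|l' nl].
    rewrite adjmxE mxE (bigD1 k) //= big1 ?addr0 => [|k' nk].
      by rewrite mxE !eqxx mulr1.
    by rewrite mxE (negPf nk) mulr0.
  by rewrite mxE big1 ?mul0r // => k' _; rewrite mxE (negPf nl) andbF mulr0.
rewrite mxE exchange_big mulr_sumr /=; apply: eq_bigr => d _.
rewrite mxE mulr_suml mulr_sumr; apply: eq_bigr => c _.
by rewrite adjmxE tensmxE adjmxE tensmxE rmorphM /=; ring.
Qed.

(** Tensoring with the identity map turns conjugation by [K] into conjugation by [tensmx 1%:M K],
    which preserves [psd]. *)
Lemma completely_positive_conj n m (K : 'M[C]_(m, n)) :
  completely_positive (fun X => K *m X *m adjmx K).
Proof.
move=> k A pA; have -> : tensmap id (fun X => K *m X *m adjmx K) A =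
    tensmx (1%:M : 'M_k) K *m A *m adjmx (tensmx 1%:M K).
  rewrite -tensmap_conj; apply: mxtens_matrixP => i a j b; rewrite !tensmapE.
  apply: eq_bigr => x _; apply: eq_bigr => y _.
  suff -> : adjmx (1%:M : 'M[C]_k) = 1%:M by rewrite mulmx1 mul1mx.
  by rewrite /adjmx map_mx1 trmx1.
exact: psd_conj.
Qed.

(** Linearity is bundled because [decomposable] asks for it separately from complete positivity. *)
Definition cplin n m (Phi : 'M[C]_n -> 'M[C]_m) :=
  linmap Phi /\ completely_positive Phi.

Lemma cplin_ext n m (Phi Psi : 'M[C]_n -> 'M[C]_m) :
  Phi =1 Psi -> cplin Phi -> cplin Psi.
Proof.
move=> e [l cp]; split=> [a X Y|k A pA]; first by rewrite -!e.
suff <- : tensmap id Phi A = tensmap (@id 'M_k) Psi A by exact: cp.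
by apply: mxtens_matrixP => i a j b; rewrite !tensmap_idE e.
Qed.

Lemma cplin_conj n m (K : 'M[C]_(m, n)) : cplin (fun X => K *m X *m adjmx K).
Proof.
split; last exact: completely_positive_conj.
by move=> a X Y; rewrite mulmxDr mulmxDl -scalemxAr -scalemxAl.
Qed.

Lemma cplinD n m (Phi Psi : 'M[C]_n -> 'M[C]_m) :
  cplin Phi -> cplin Psi -> cplin (fun X => Phi X + Psi X).
Proof.
move=> [l1 c1] [l2 c2]; split=> [a X Y|k A pA].
  by rewrite l1 l2 scalerDr addrACA.
suff -> : tensmap id (fun X => Phi X + Psi X) A =
    tensmap (@id 'M_k) Phi A + tensmap id Psi A by exact: psdD (c1 _ _ pA) (c2 _ _ pA).
by apply: mxtens_matrixP => i a j b; rewrite mxE !tensmap_idE mxE.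
Qed.

Lemma cplinZ n m (c : C) (Phi : 'M[C]_n -> 'M[C]_m) :
  0 <= c -> cplin Phi -> cplin (fun X => c *: Phi X).
Proof.
move=> c0 [l1 c1]; split=> [a X Y|k A pA].
  by rewrite l1 scalerDr !scalerA [c * a]mulrC.
suff -> : tensmap id (fun X => c *: Phi X) A =
    c *: tensmap (@id 'M_k) Phi A by exact: psdZ c0 (c1 _ _ pA).
by apply: mxtens_matrixP => i a j b; rewrite mxE !tensmap_idE mxE.
Qed.

Lemma cplin0 n m : cplin (fun _ : 'M[C]_n => 0 : 'M[C]_m).
Proof.
have := cplinZ (lexx 0) (@cplin_conj n m 0).
by apply: cplin_ext => X; rewrite scale0r.
Qed.

Lemma cplin_sum n m I (r : seq I) (Phi : I -> 'M[C]_n -> 'M[C]_m) :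
  (forall i, cplin (Phi i)) -> cplin (fun X => \sum_(i <- r) Phi i X).
Proof.
move=> cPhi; elim: r => [|x r IH].
  by apply: cplin_ext (cplin0 _ _) => X; rewrite big_nil.
by apply: cplin_ext (cplinD (cPhi x) IH) => X; rewrite big_cons.
Qed.

Definition krausmap n m (s : seq 'M[C]_(m, n)) (X : 'M[C]_n) : 'M[C]_m :=
  \sum_(K <- s) K *m X *m adjmx K.

(** The matrices [tensmx K L] are Kraus operators of the tensor product; the proof reorders the
    sums. *)
Lemma cplin_tens_kraus n1 m1 n2 m2 (s1 : seq 'M[C]_(m1, n1))
    (s2 : seq 'M[C]_(m2, n2)) : cplin (tensmap (krausmap s1) (krausmap s2)).
Proof.
have := @cplin_sum _ _ _ s1 _ (fun K => @cplin_sum _ _ _ s2 _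
  (fun L => cplin_conj (tensmx K L))).
apply: cplin_ext => X; apply: mxtens_matrixP => i a j b.
rewrite tensmapE summxE.
under eq_bigr => K _.
  rewrite summxE; under eq_bigr => L _ do rewrite -tensmap_conj tensmapE.
  rewrite exchange_big; under eq_bigr do rewrite exchange_big.
  over.
rewrite exchange_big; apply: eq_bigr => k _.
rewrite exchange_big; apply: eq_bigr => l _.
rewrite /krausmap !summxE mulr_suml.
by apply: eq_bigr => K _; rewrite mulr_sumr.
Qed.

(** * Positivity *)

Lemma form_delta n (A : 'M[C]_n) i j :
  (adjv (delta_mx i 0) *m A *m delta_mx j 0 : 'M_1) 0 0 = A i j.
Proof.
rewrite mxE (bigD1 j) //= big1 ?addr0 => [|j' nj]; last first.
  by rewrite [X in _ * X]mxE (negPf nj) mulr0.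
rewrite [X in _ * X]mxE !eqxx mulr1 mxE (bigD1 i) //= big1 ?addr0 => [|i' ni].
  by rewrite !mxE !eqxx conjC1 mul1r.
by rewrite !mxE (negPf ni) conjC0 mul0r.
Qed.

(** Polarisation at [e_i + c e_j]: taking c = 1 gives [A i j = - A j i], and c the imaginary unit
    gives [A i j = A j i]. *)
Lemma form_eq0 n (A : 'M[C]_n) :
  (forall v, (adjv v *m A *m v) 0 0 = 0) -> A = 0.
Proof.
move=> A0.
have polar (c : C) i j : c * A i j + c^* * A j i = 0.
  have := A0 (delta_mx i 0 + c *: delta_mx j 0).
  have -> : adjv (delta_mx i 0 + c *: delta_mx j 0) =
      adjv (delta_mx i 0) + c^* *: adjv (delta_mx j 0 : 'cV[C]_n).
    by apply/matrixP => x y; rewrite !mxE rmorphD rmorphM.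
  rewrite !(mulmxDl, mulmxDr) -!(scalemxAl, scalemxAr) => /esym.
  have eD (M N : 'M[C]_1) : (M + N) 0 0 = M 0 0 + N 0 0 by rewrite mxE.
  have eZ (a : C) (M : 'M[C]_1) : (a *: M) 0 0 = a * M 0 0 by rewrite mxE.
  rewrite !(eD, eZ) !form_delta.
  have := A0 (delta_mx i 0); rewrite form_delta => ->.
  have := A0 (delta_mx j 0); rewrite form_delta => -> e.
  by rewrite [RHS]e; ring.
apply/matrixP => i j; rewrite mxE.
have := polar 1 i j; rewrite conjC1 !mul1r => e1.
have := polar Num.imaginary i j; rewrite conjCi mulNr -mulrBr => /eqP.
rewrite mulf_eq0 (negPf (neq0Ci _)) subr_eq0 => /eqP e2.
have : A i j * 2 = 0 by rewrite mulr_natr mulr2n {2}e2.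
by move/eqP; rewrite mulf_eq0 pnatr_eq0 orbF => /eqP.
Qed.

(** The form of [adjmx A] is the conjugate of that of [A], which is real, so [form_eq0] applies to
    the difference. *)
Lemma psd_adjmx n (A : 'M[C]_n) : psd A -> adjmx A = A.
Proof.
move=> pA; apply/eqP; rewrite -subr_eq0; apply/eqP/form_eq0 => v.
rewrite mulmxBr mulmxBl mxE [X in _ + X]mxE.
have -> : (adjv v *m adjmx A *m v) 0 0 = ((adjv v *m A *m v) 0 0)^*.
  rewrite -[in RHS]adjmxE !adjmx_mul [adjmx (adjv v)]adjmxK.
  by rewrite mulmxA.
by rewrite (CrealP (ger0_real (pA v))) subrr.
Qed.

(** A hermitian matrix is normal, hence unitarily diagonalisable; each eigenvalue is a value of a
    positive form at a basis vector. *)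
Lemma psd_spectral n (A : 'M[C]_n) : psd A ->
  exists2 d : 'I_n -> C, (forall i, 0 <= d i) &
  exists v : 'I_n -> 'cV[C]_n, A = \sum_i d i *: (v i *m adjv (v i)).
Proof.
move=> pA; have hA := psd_adjmx pA.
have /orthomx_spectralP : A \is normalmx.
  apply/normalmxP; suff -> : (A^t*)%sesqui = A by [].
  by rewrite -[RHS]hA /adjmx map_trmx.
have uP := spectral_unitarymx A; rewrite invmx_unitary //.
set P := spectralmx A in uP *; set D := spectral_diag A => eA.
have aP : adjmx P = (P^t*)%sesqui by rewrite /adjmx map_trmx.
have PP : P *m adjmx P = 1%:M by rewrite aP; apply/unitarymxP.
rewrite -aP in eA.
have eD : P *m A *m adjmx P = diag_mx D.
  by rewrite eA !mulmxA PP mul1mx -mulmxA PP mulmx1.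
exists (fun i => D 0 i) => [i|].
  have := psd_conj P pA (delta_mx i 0); rewrite eD form_delta mxE eqxx.
  by rewrite mulr1n.
exists (fun i => col i (adjmx P)); apply/matrixP => a b.
rewrite {1}eA -mulmxA mul_diag_mx mxE summxE; apply: eq_bigr => i _.
by rewrite !mxE big_ord1 !mxE conjCK; ring.
Qed.

Lemma positive_map_rank1 n m (Phi : 'M[C]_n -> 'M[C]_m) :
  linmap Phi -> (forall v, psd (Phi (v *m adjv v))) -> positive_map Phi.
Proof.
move=> lPhi pPhi A /psd_spectral[d d0 [v ->]].
have Phi0 : Phi 0 = 0.
  have := lPhi 1 0 0; rewrite !scale1r addr0 => /eqP.
  by rewrite -subr_eq subrr => /eqP.
suff -> : Phi (\sum_i d i *: (v i *m adjv (v i))) =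
    \sum_i d i *: Phi (v i *m adjv (v i)).
  by apply: psd_sum => i; apply: psdZ (d0 i) (pPhi _).
elim/big_rec2: _ => [//|i y x _ <-]; exact: lPhi.
Qed.

(** * Entries of the two qubit maps and of their tensor product *)

Lemma blockmx_lin p n (a : C) (X Y : 'M[C]_(p * n)) i j :
  blockmx (a *: X + Y) i j = a *: blockmx X i j + blockmx Y i j.
Proof. by apply/matrixP => x y; rewrite !mxE. Qed.

Lemma linmap_tens p1 p2 n m (A : 'M[C]_p1 -> 'M[C]_p2) (B : 'M[C]_n -> 'M[C]_m) :
  linmap B -> linmap (tensmap A B).
Proof.
move=> lB a X Y; apply: mxtens_matrixP => i x j y.
rewrite !mxE !tensmapE mulr_sumr -big_split; apply: eq_bigr => k _ /=.
rewrite mulr_sumr -big_split; apply: eq_bigr => l _ /=.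
by rewrite blockmx_lin lB !mxE; ring.
Qed.

(** The matrices [sigma2] and [sigma4] span the off-diagonal matrices, so their two terms add up to
    [b] times the off-diagonal part. *)
Lemma PimapE (b : R) Y i j :
  Pimap b Y i j = if i == j then (Y 0 0 + Y 1 1) / 2 else b%:C * Y i j.
Proof.
have tr2 (Z : 'M[C]_2) : \tr Z = Z 0 0 + Z 1 1 by rewrite /mxtrace sum_ord2.
rewrite /Pimap !tr2 /sigma2 /sigma4.
have ii : ('i * 'i = -1 :> C)%C by rewrite -expr2 sqr_i.
case: (ord2P i) => ->; case: (ord2P j) => ->;
  rewrite !(mxE, sum_ord2) /=; by field: ii.
Qed.

Lemma linmap_Pimap (b : R) : linmap (Pimap b).
Proof.
move=> a X Y; apply/matrixP => i j; rewrite PimapE [RHS]mxE [X in _ = X + _]mxE !PimapE !mxE.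
by case: eqP => _; ring.
Qed.

Lemma Tmap_delta (t : R) k l i j :
  Tmap t (delta_mx k l) i j =
  ((1 - t) / 2)%:C * ((k == l) && (i == j))%:R +
  t%:C * ((i == k) && (j == l))%:R.
Proof.
have e2 : (2 : C) = 2%:C by rewrite rmorph_nat.
have -> : ((1 - t) / 2)%:C = (1 - t)%:C / 2 by rewrite e2 fmorph_div.
rewrite /Tmap /mxtrace sum_ord2 !mxE.
case: (ord2P i) => ->; case: (ord2P j) => ->; case: (ord2P k) => ->;
  case: (ord2P l) => -> /=; ring.
Qed.

(** Resums the expansion of [tensmap] over matrix units of the first factor. *)
Lemma sum_Tmap_delta (t : R) (p : 'I_2 -> 'I_2 -> C) i j :
  \sum_k \sum_l Tmap t (delta_mx k l) i j * p k l =
  ((1 - t) / 2)%:C * (i == j)%:R * (p 0 0 + p 1 1) + t%:C * p i j.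
Proof.
under eq_bigr do under eq_bigr do rewrite Tmap_delta.
rewrite !sum_ord2.
by case: (ord2P i) => ->; case: (ord2P j) => -> /=; ring.
Qed.

Lemma real_complex_half (x : R) : (x / 2)%:C = x%:C / 2.
Proof. by rewrite fmorph_div rmorph_nat. Qed.

Lemma blockmxE p n (X : 'M[C]_(p * n)) i j a c :
  blockmx X i j a c = X (mxtens_index (i, a)) (mxtens_index (j, c)).
Proof. by rewrite mxE. Qed.

Lemma rank1E n (v : 'cV[C]_n) i j : (v *m adjv v) i j = v i 0 * (v j 0)^*.
Proof. by rewrite mxE big_ord1 adjmxE. Qed.

Lemma TPi_rank1E (t b : R) (v : 'cV[C]_(2 * 2)) i a j c :
  let f i a := v (mxtens_index (i, a)) 0 in
  let g k l := if a == c then (f k 0 * (f l 0)^* + f k 1 * (f l 1)^*) / 2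
               else b%:C * (f k a * (f l c)^*) in
  TPi t b (v *m adjv v) (mxtens_index (i, a)) (mxtens_index (j, c)) =
  (1 - t%:C) / 2 * (i == j)%:R * (g 0 0 + g 1 1) + t%:C * g i j.
Proof.
move=> f g.
have gE k l : Pimap b (blockmx (v *m adjv v) k l) a c = g k l.
  rewrite PimapE. rewrite !blockmxE. by rewrite !rank1E.
have -> : (1 - t%:C) / 2 = ((1 - t) / 2)%:C by rewrite real_complex_half rmorphB rmorph1.
rewrite -sum_Tmap_delta /TPi tensmapE.
by apply: eq_bigr => k _; apply: eq_bigr => l _; congr (_ * _); exact: gE.
Qed.

Lemma form_mxtensE m n (A : 'M[C]_(m * n)) (w : 'cV[C]_(m * n))
    (H : 'I_m -> 'I_n -> 'I_m -> 'I_n -> C) :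
  (forall i a j c, A (mxtens_index (i, a)) (mxtens_index (j, c)) = H i a j c) ->
  let g i a := w (mxtens_index (i, a)) 0 in
  (adjv w *m A *m w) 0 0 =
  \sum_i \sum_a \sum_j \sum_c (g i a)^* * H i a j c * g j c.
Proof.
move=> AH g.
under [RHS]eq_bigr do rewrite exchange_big; rewrite [RHS]exchange_big /=.
rewrite mxE sum_mxtens; apply: eq_bigr => j _.
under [RHS]eq_bigr do rewrite exchange_big; rewrite [RHS]exchange_big /=.
apply: eq_bigr => c _; rewrite mxE sum_mxtens mulr_suml.
apply: eq_bigr => i _; rewrite mulr_suml; apply: eq_bigr => a _.
by rewrite adjmxE AH.
Qed.

Lemma TPi_formE (t b : R) (v w : 'cV[C]_(2 * 2)) :
  let f i a := v (mxtens_index (i, a)) 0 in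
  let g i a := w (mxtens_index (i, a)) 0 in
  let p := (g 0 0)^* * f 0 0 + (g 1 0)^* * f 1 0 in
  let q := (f 0 1)^* * g 0 1 + (f 1 1)^* * g 1 1 in
  let r := (g 0 1)^* * f 0 0 + (g 1 1)^* * f 1 0 in
  let s := (g 0 0)^* * f 0 1 + (g 1 0)^* * f 1 1 in
  let A := ((f 0 1)^* * f 0 0 + (f 1 1)^* * f 1 0) *
    ((g 0 0)^* * g 0 1 + (g 1 0)^* * g 1 1) in
  let N := f 0 0 * (f 0 0)^* + f 1 0 * (f 1 0)^* +
    (f 0 1 * (f 0 1)^* + f 1 1 * (f 1 1)^*) in
  let M := g 0 0 * (g 0 0)^* + g 1 0 * (g 1 0)^* +
    (g 0 1 * (g 0 1)^* + g 1 1 * (g 1 1)^*) in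
  4 * (adjv w *m TPi t b (v *m adjv v) *m w) 0 0 =
  (1 - t%:C) * (N * M) + 2 * (b%:C * (1 - t%:C)) * (A + A^*)
       + 2 * t%:C * (p * p^* + q * q^* + r * r^* + s * s^*)
       + 4 * (t%:C * b%:C) * (p * q + (p * q)^*).
Proof.
move=> f g p q r s A N M.
rewrite -[RHS]TPi_form_algebra; congr (4 * _).
by apply: form_mxtensE => i a j c; exact: TPi_rank1E.
Qed.

Lemma positive_TPi (t b : R) :
  0 <= t <= 1 -> 0 <= b <= 1 -> 2 * b * t <= 1 -> positive_map (TPi t b).
Proof.
move=> /andP[t0 t1] /andP[b0 b1] tb.
apply: positive_map_rank1 => [|v w]; first exact/linmap_tens/linmap_Pimap.
rewrite -(pmulr_rge0 _ (ltr0n C 4)) TPi_formE.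
by apply: TPi_form_ge0;
  rewrite -?(rmorph1 (real_complex R)) -?(rmorph_nat (real_complex R)) -?rmorphM
    ?ler0c ?lecR.
Qed.

Lemma positive_TPi_le1 (t b : R) : positive_map (TPi t b) -> 2 * b * t <= 1.
Proof.
move=> pos.
(* The Bell vectors [e_00 + e_11] and [e_00 - e_11] give p = 1, q = -1, r = s = A = 0 and N = M = 2,
   so four times the form is [4 - 8 * (b * t)]. *)
pose v : 'cV[C]_(2 * 2) := \col_x (let ia := mxtens_unindex x in (ia.1 == ia.2)%:R).
pose w : 'cV[C]_(2 * 2) := \col_x
  (let ia := mxtens_unindex x in if ia.1 == ia.2 then (-1) ^+ (val ia.1) else 0).
have vE i a : v (mxtens_index (i, a)) 0 = (i == a)%:R by rewrite mxE mxtens_indexK.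
have wE i a : w (mxtens_index (i, a)) 0 = if i == a then (-1) ^+ (val i) else 0.
  by rewrite mxE mxtens_indexK.
have := pos _ (psd_rank1 v) w.
rewrite -(pmulr_rge0 _ (ltr0n C 4)) TPi_formE !vE !wE /=.
rewrite !(conjC0, conjC1, rmorphN, mulr0, mul0r, addr0, add0r, expr0, expr1,
  mulr1, mul1r) /=.
rewrite !conjC1; set z := (X in 0 <= X).
have -> : z = (4 - 8 * (b * t))%:C.
  by rewrite /z rmorphB !rmorphM !rmorph_nat; ring.
by rewrite ler0c => h; lra.
Qed.

(** * Decomposability *)

Let E (i j : 'I_2) : 'M[C]_2 := delta_mx i j.

Lemma conj_ord2E (K X : 'M[C]_2) i j : (K *m X *m adjmx K) i j =
  (K i 0 * X 0 0 + K i 1 * X 1 0) * (K j 0)^* +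
  (K i 0 * X 0 1 + K i 1 * X 1 1) * (K j 1)^*.
Proof. by rewrite mxE sum_ord2 !adjmxE !mxE !sum_ord2. Qed.

Lemma kraus_idE (X : 'M[C]_2) : krausmap [:: (1%:M : 'M[C]_2)] X = X.
Proof.
have a1 : adjmx (1%:M : 'M[C]_2) = 1%:M.
  by apply/matrixP => i j; rewrite !mxE eq_sym conjC_nat.
by rewrite /krausmap big_seq1 a1 mulmx1 mul1mx.
Qed.

Lemma krausmap_consE (s : seq 'M[C]_2) (K X : 'M[C]_2) i j :
  krausmap (K :: s) X i j =
  (K i 0 * X 0 0 + K i 1 * X 1 0) * (K j 0)^* +
  (K i 0 * X 0 1 + K i 1 * X 1 1) * (K j 1)^* + krausmap s X i j.
Proof. by rewrite /krausmap big_cons mxE conj_ord2E. Qed.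

Lemma krausmap_nilE (X : 'M[C]_2) i j : krausmap (m := 2) [::] X i j = 0.
Proof. by rewrite /krausmap big_nil mxE. Qed.

Ltac kraus X i j :=
  rewrite !krausmap_consE krausmap_nilE;
  case: (ord2P i) => ->; case: (ord2P j) => ->;
  move: (X 0 0) (X 0 1) (X 1 0) (X 1 1) => x y z w;
  rewrite ?mxE /=;
  rewrite ?(conjC0, conjC1, rmorphN, rmorphD, rmorph0, rmorph1) /=; ring.

Lemma kraus_trE (X : 'M[C]_2) i j :
  krausmap [:: E 0 0; E 0 1; E 1 0; E 1 1] X i j = (i == j)%:R * (X 0 0 + X 1 1).
Proof. kraus X i j. Qed.

Lemma kraus_diagE (X : 'M[C]_2) i j :
  krausmap [:: E 0 0; E 1 1] X i j = (i == j)%:R * X i j.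
Proof. kraus X i j. Qed.

Lemma kraus_flipE (X : 'M[C]_2) i j :
  krausmap [:: E 0 1; E 1 0] X i j = (i == j)%:R * (X 0 0 + X 1 1 - X i j).
Proof. kraus X i j. Qed.

Lemma kraus_sigma2E (X : 'M[C]_2) i j :
  krausmap [:: E 0 1 + E 1 0] X i j =
  if i == j then X 0 0 + X 1 1 - X i j else X j i.
Proof. kraus X i j. Qed.

(** The antisymmetric Kraus operator: composed with the transpose, this is the reduction map tr(X) 1
    - X. *)
Lemma kraus_spinflipE (X : 'M[C]_2) i j :
  krausmap [:: E 0 1 - E 1 0] X i j = (i == j)%:R * (X 0 0 + X 1 1) - X j i.
Proof. kraus X i j. Qed.

(** Kraus operators from an orthogonal basis of the symmetric matrices. Doubling [E 0 0] and [E 1 1]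
    and listing [E 0 1 + E 1 0] twice avoids square roots of 2, whence the factor 2. *)
Lemma kraus_symE (X : 'M[C]_2) i j :
  krausmap [:: E 0 0 + E 0 0; E 0 1 + E 1 0; E 0 1 + E 1 0; E 1 1 + E 1 1] X i j =
  2 * ((i == j)%:R * (X 0 0 + X 1 1) + X j i).
Proof. kraus X i j. Qed.

(** The first-factor maps of the decomposition all lie in the span of the identity, the transpose
    and tr(X) 1, so one formula serves them all. *)
Lemma sum_delta_ord2 (A : 'M[C]_2 -> 'M[C]_2) (p : 'I_2 -> 'I_2 -> C) (x y z : C) i j :
  (forall Y, A Y i j = x * Y i j + y * Y j i + z * ((i == j)%:R * (Y 0 0 + Y 1 1))) ->
  \sum_k \sum_l A (delta_mx k l) i j * p k l =
  x * p i j + y * p j i + z * ((i == j)%:R * (p 0 0 + p 1 1)).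
Proof.
move=> AE; rewrite !sum_ord2 !AE !mxE.
by case: (ord2P i) => ->; case: (ord2P j) => -> /=; ring.
Qed.

Lemma tensmap_ord2E (A B : 'M[C]_2 -> 'M[C]_2) (X : 'M[C]_(2 * 2)) (x y z : C) i a j c :
  (forall Y, A Y i j = x * Y i j + y * Y j i + z * ((i == j)%:R * (Y 0 0 + Y 1 1))) ->
  tensmap A B X (mxtens_index (i, a)) (mxtens_index (j, c)) =
  x * B (blockmx X i j) a c + y * B (blockmx X j i) a c +
  z * ((i == j)%:R * (B (blockmx X 0 0) a c + B (blockmx X 1 1) a c)).
Proof.
by move=> AE; rewrite tensmapE (sum_delta_ord2 (fun k l => B (blockmx X k l) a c) AE).
Qed.

Let kid := krausmap [:: (1%:M : 'M[C]_2)].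
Let ktr := krausmap [:: E 0 0; E 0 1; E 1 0; E 1 1].
Let kdiag := krausmap [:: E 0 0; E 1 1].
Let kflip := krausmap [:: E 0 1; E 1 0].
Let ksigma2 := krausmap [:: E 0 1 + E 1 0].
Let kspinflip := krausmap [:: E 0 1 - E 1 0].
Let ksym := krausmap [:: E 0 0 + E 0 0; E 0 1 + E 1 0; E 0 1 + E 1 0; E 1 1 + E 1 1].

Lemma linear_combination_entry n (c1 c2 c3 c4 c5 c6 d1 d2 d3 : C)
    (M1 M2 M3 M4 M5 M6 N1 N2 N3 : 'M[C]_n) y z m1 m2 m3 m4 m5 m6 n1 n2 n3 :
  M1 y z = m1 -> M2 y z = m2 -> M3 y z = m3 -> M4 y z = m4 -> M5 y z = m5 ->
  M6 y z = m6 -> N1 z y = n1 -> N2 z y = n2 -> N3 z y = n3 ->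
  (c1 *: M1 + c2 *: M2 + c3 *: M3 + c4 *: M4 + c5 *: M5 + c6 *: M6
    + (d1 *: N1 + d2 *: N2 + d3 *: N3)^T) y z =
  c1 * m1 + c2 * m2 + c3 * m3 + c4 * m4 + c5 * m5 + c6 * m6
    + (d1 * n1 + d2 * n2 + d3 * n3).
Proof. by do 9?[move=> <-]; rewrite !mxE. Qed.

(* Otherwise each failed unification between matrix entries unfolds these. *)
Local Opaque tensmap krausmap Pimap Tmap.

(* Let tr X = (trace of X) 1, F [[p, q], [r, s]] = diag(s, p), G = diagonal part
   and H [[p, q], [r, s]] = [[s, q], [r, p]].  The map is written as
     (t b - h) id*id + k tr*id + (nonnegative part on {id, tr}*{F, G})
     + h (tr + id)*H + g tr*H + f (tr - id)*G,
   where the last three products are co-completely positive; comparing the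
   coefficients on {id, tr}*{F, G, off-diagonal part} gives the hypotheses. *)
Lemma decomposable_TPi_coef (t b h g f k : R) :
  0 <= h -> 0 <= g -> 0 <= f -> 0 <= k ->
  h + g + k = (1 - t) * b / 2 -> h + g <= (1 - t) / 4 -> f + k <= (1 - t) / 4 ->
  h <= t * b -> h <= t / 2 -> t * b - h - f <= t / 2 ->
  decomposable (TPi t b).
Proof.
move=> h0 g0 f0 k0 eQ hF hG hQ1 hF1 hG1.
have ge0 (x : R) : 0 <= x -> 0 <= x%:C by rewrite ler0c.
have cp s1 s2 (x : R) : 0 <= x ->
    cplin (fun X => x%:C *: tensmap (krausmap s1) (krausmap s2) X : 'M[C]_(2 * 2)).
  by move=> x0; apply: cplinZ; [exact: ge0|exact: cplin_tens_kraus].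
pose T X := (t * b - h)%:C *: tensmap kid kid X + k%:C *: tensmap ktr kid X
  + (t / 2 - h)%:C *: tensmap kid kflip X
  + (t / 2 - (t * b - h - f))%:C *: tensmap kid kdiag X
  + ((1 - t) / 4 - (h + g))%:C *: tensmap ktr kflip X
  + ((1 - t) / 4 - (f + k))%:C *: tensmap ktr kdiag X.
pose S X := (h / 2)%:C *: tensmap ksym ksigma2 X + g%:C *: tensmap ktr ksigma2 X
  + f%:C *: tensmap kspinflip kdiag X.
have [lT cT] : cplin T.
  by do 5?[apply: cplinD]; apply: cp; rewrite ?subr_ge0.
have [lS cS] : cplin S.
  by do 2?[apply: cplinD]; apply: cp; rewrite ?divr_ge0.
exists T, S; split=> // X; apply: mxtens_matrixP => i a j c.
have kidE Y i' j' : kid Y i' j' = 1 * Y i' j' + 0 * Y j' i' +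
    0 * ((i' == j')%:R * (Y 0 0 + Y 1 1)).
  by rewrite /kid kraus_idE; ring.
have ktrE Y i' j' : ktr Y i' j' = 0 * Y i' j' + 0 * Y j' i' +
    1 * ((i' == j')%:R * (Y 0 0 + Y 1 1)).
  by rewrite /ktr kraus_trE; ring.
have kspE Y i' j' : kspinflip Y i' j' = 0 * Y i' j' + (-1) * Y j' i' +
    1 * ((i' == j')%:R * (Y 0 0 + Y 1 1)).
  by rewrite /kspinflip kraus_spinflipE; ring.
have ksymE Y i' j' : ksym Y i' j' = 0 * Y i' j' + 2 * Y j' i' +
    2 * ((i' == j')%:R * (Y 0 0 + Y 1 1)).
  by rewrite /ksym kraus_symE; ring.
pose x k l a c := blockmx X k l a c.
pose G k l := if a == c then (x k l 0 0 + x k l 1 1) / 2 else b%:C * x k l a c.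
have TE : TPi t b X (mxtens_index (i, a)) (mxtens_index (j, c)) =
  ((1 - t) / 2)%:C * (i == j)%:R * (G 0 0 + G 1 1) + t%:C * G i j.
  rewrite -sum_Tmap_delta /TPi tensmapE.
  by apply: eq_bigr => ? _; apply: eq_bigr => ? _; congr (_ * _); exact: PimapE.
rewrite TE {TE}.
have T1 (B : 'M[C]_2 -> 'M[C]_2) i' a' j' c' :
    tensmap kid B X (mxtens_index (i', a')) (mxtens_index (j', c')) =
    B (blockmx X i' j') a' c'.
  by rewrite (tensmap_ord2E B X a' c' (fun Y => kidE Y i' j')); ring.
have T2 (B : 'M[C]_2 -> 'M[C]_2) i' a' j' c' :
    tensmap ktr B X (mxtens_index (i', a')) (mxtens_index (j', c')) =
    (i' == j')%:R * (B (blockmx X 0 0) a' c' + B (blockmx X 1 1) a' c').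
  by rewrite (tensmap_ord2E B X a' c' (fun Y => ktrE Y i' j')); ring.
have T3 (B : 'M[C]_2 -> 'M[C]_2) i' a' j' c' :
    tensmap kspinflip B X (mxtens_index (i', a')) (mxtens_index (j', c')) =
    (i' == j')%:R * (B (blockmx X 0 0) a' c' + B (blockmx X 1 1) a' c')
    - B (blockmx X j' i') a' c'.
  by rewrite (tensmap_ord2E B X a' c' (fun Y => kspE Y i' j')); ring.
have T4 (B : 'M[C]_2 -> 'M[C]_2) i' a' j' c' :
    tensmap ksym B X (mxtens_index (i', a')) (mxtens_index (j', c')) =
    2 * ((i' == j')%:R * (B (blockmx X 0 0) a' c' + B (blockmx X 1 1) a' c')
    + B (blockmx X j' i') a' c').
  by rewrite (tensmap_ord2E B X a' c' (fun Y => ksymE Y i' j')); ring.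
have kfE Y a' c' : kflip Y a' c' = (a' == c')%:R * (Y 0 0 + Y 1 1 - Y a' c').
  exact: kraus_flipE.
have kdE Y a' c' : kdiag Y a' c' = (a' == c')%:R * Y a' c' by exact: kraus_diagE.
have kiE Y : kid Y = Y by exact: kraus_idE.
have ksE Y a' c' : ksigma2 Y a' c' =
    if a' == c' then Y 0 0 + Y 1 1 - Y a' c' else Y c' a' by exact: kraus_sigma2E.
clear lT cT lS cS; rewrite {}/T {}/S.
(* From here on only the entry formulas of these maps are used. *)
clearbody kid ktr kspinflip ksym kflip kdiag ksigma2.
have bE m n u v : blockmx X m n u v = x m n u v by [].
have eid m n : kid (blockmx X m n) a c = x m n a c by rewrite kiE.
have ef m n : kflip (blockmx X m n) a c =
    (a == c)%:R * (x m n 0 0 + x m n 1 1 - x m n a c) by rewrite kfE.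
have ed m n : kdiag (blockmx X m n) a c = (a == c)%:R * x m n a c by rewrite kdE.
have ed' m n : kdiag (blockmx X m n) c a = (c == a)%:R * x m n c a by rewrite kdE.
have es m n : ksigma2 (blockmx X m n) c a =
    if c == a then x m n 0 0 + x m n 1 1 - x m n c a else x m n a c by rewrite ksE.
apply: esym; apply: etrans (linear_combination_entry _ _ _ _ _ _ _ _ _
  (T1 _ _ _ _ _) (T2 _ _ _ _ _) (T1 _ _ _ _ _) (T1 _ _ _ _ _) (T2 _ _ _ _ _) (T2 _ _ _ _ _)
  (T4 _ _ _ _ _) (T2 _ _ _ _ _) (T3 _ _ _ _ _)) _.
rewrite !eid !ef !ed !ed' !es {}/G.
(* Eliminating [k] turns each entry into an identity in the free parameters t, b, h, g, f. *)
have kE : k = (1 - t) * b / 2 - (h + g) by rewrite -eQ; ring.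
rewrite kE !(rmorphB, rmorphD, rmorphM, fmorphV, rmorph_nat, rmorph1) /=.
move: (t%:C) (b%:C) (h%:C) (g%:C) (f%:C) => t' b' h' g' f'.
move: x {bE eid ef ed ed' es T1 T2 T3 T4 kfE kdE kiE ksE kidE ktrE kspE ksymE} => x.
case: (ord2P i) => ->; case: (ord2P j) => ->; case: (ord2P a) => ->;
  case: (ord2P c) => -> /=.
all: by field.
Qed.

Lemma decomposable_TPi (t b : R) :
  0 <= t <= 1 -> 0 <= b <= 1 -> 2 * b + t + 2 * b * t <= 3 ->
  decomposable (TPi t b).
Proof.
move=> /andP[t0 t1] /andP[b0 b1] tb.
(* For b at most 1/2 the co-completely positive part can be zero. *)
case: (lerP b (1 / 2)) => b2.
  by apply: (@decomposable_TPi_coef t b 0 0 0 ((1 - t) * b / 2)); nra.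
(* Now [f + k] and [h + g] both take their maximum (1 - t)/4, and h is the minimum of t/2 and (1 -
   t)/4, which switches at t = 1/3. For larger t the last constraint is exactly the hypothesis [tb];
   for smaller t it reduces to t b <= t. *)
case: (lerP (1 / 3) t) => t3.
  by apply: (@decomposable_TPi_coef t b ((1 - t) / 4) 0 ((1 - t) * (1 - b) / 2)
    ((1 - t) * (2 * b - 1) / 4)); nra.
by apply: (@decomposable_TPi_coef t b (t / 2) ((1 - 3 * t) / 4)
  ((1 - t) * (1 - b) / 2) ((1 - t) * (2 * b - 1) / 4)); nra.
Qed.

(** * Non-decomposability *)

(** Positivity of the Choi matrix, the image of the maximally entangled [w *m adjv w], at a vector
    listed by its coordinates. Integer coefficients are fixed by conjugation. *)
Lemma cp_choi_ge0 n m (Phi : 'M[C]_n -> 'M[C]_m) (s : seq (int * ('I_n * 'I_m))) :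
  completely_positive Phi ->
  0 <= \sum_(x <- s) \sum_(y <- s)
    x.1%:~R * y.1%:~R * Phi (delta_mx x.2.1 y.2.1) x.2.2 y.2.2.
Proof.
move=> cp.
pose w : 'cV[C]_(n * n) :=
  \col_z (let ij := mxtens_unindex z in (ij.1 == ij.2)%:R).
have wE i j : w (mxtens_index (i, j)) 0 = (i == j)%:R by rewrite mxE mxtens_indexK.
have bE k l : blockmx (w *m adjv w) k l = delta_mx k l.
  apply/matrixP => i j; rewrite blockmxE rank1E !wE conjC_nat mxE -natrM mulnb.
  by rewrite ![_ == k]eq_sym ![_ == l]eq_sym.
pose d (x : int * ('I_n * 'I_m)) : 'cV[C]_(n * m) := delta_mx (mxtens_index x.2) 0.
pose v : 'cV[C]_(n * m) := \sum_(x <- s) x.1%:~R *: d x.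
have := cp n _ (psd_rank1 w) v.
have -> : adjv v = \sum_(x <- s) x.1%:~R *: adjv (d x).
  apply/matrixP => i j; rewrite !mxE summxE rmorph_sum summxE.
  by apply: eq_bigr => x _; rewrite !mxE rmorphM /= rmorph_int.
rewrite mulmx_suml mulmx_suml summxE.
congr (0 <= _); apply: eq_bigr => x _.
rewrite mulmx_sumr summxE; apply: eq_bigr => y _.
rewrite -!scalemxAl -scalemxAr scalerA mxE form_delta.
by case: x => [c [k a]]; case: y => [c' [l a']]; rewrite tensmap_idE bE.
Qed.

Let o (x : bool) : 'I_2 := if x then 1 else 0.

(* Indices are booleans so that [ring] separates the entries by constructors. *)
Definition entries (Phi : 'M[C]_(2 * 2) -> 'M[C]_(2 * 2)) k1 k2 l1 l2 a1 a2 c1 c2 :=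
  Phi (delta_mx (mxtens_index (o k1, o k2)) (mxtens_index (o l1, o l2)))
    (mxtens_index (o a1, o a2)) (mxtens_index (o c1, o c2)).

Let term (F : bool -> bool -> bool -> bool -> bool -> bool -> bool -> bool -> C)
  (x y z w : int * (bool * bool)) : C :=
  x.1%:~R * y.1%:~R * (z.1%:~R * w.1%:~R) *
      F x.2.1 y.2.1 z.2.1 w.2.1 x.2.2 y.2.2 z.2.2 w.2.2.

(* The Choi form of F at the vector f * g, where f and g list the nonzero
   coordinates of vectors of C^2 * C^2, as (coefficient, (input, output)). *)
Definition qform (F : bool -> bool -> bool -> bool -> bool -> bool -> bool -> bool -> C)
  (f g : seq (int * (bool * bool))) :=
  \sum_(x <- f) \sum_(y <- g) \sum_(z <- f) \sum_(w <- g) term F x y z w.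

Lemma cp_qform_ge0 Phi f g : completely_positive Phi -> 0 <= qform (entries Phi) f g.
Proof.
move=> cp.
have := @cp_choi_ge0 _ _ Phi [seq (x.1 * y.1, (mxtens_index (o x.2.1, o y.2.1),
  mxtens_index (o x.2.2, o y.2.2))) | x <- f, y <- g] cp.
rewrite big_allpairs_dep; congr (0 <= _).
apply: eq_bigr => x _; apply: eq_bigr => y _; rewrite big_allpairs_dep.
by apply: eq_bigr => z _; apply: eq_bigr => w _; rewrite !rmorphM.
Qed.

(** The projectors of [e false true] and [e true false] add up to half the sum of the unnormalised
    ones of [xi] and [psi]; likewise [e false false] and [e true true] with [omega] and [zeta].
    Using them in pairs keeps the witness Bell-diagonal. *)
Let e (k a : bool) : seq (int * (bool * bool)) := [:: (1%Z, (k, a))].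
Let omega : seq (int * (bool * bool)) := [:: (1%Z, (false, false)); (1%Z, (true, true))].
Let zeta : seq (int * (bool * bool)) := [:: (1%Z, (false, false)); ((-1)%Z, (true, true))].
Let xi : seq (int * (bool * bool)) := [:: (1%Z, (false, true)); (1%Z, (true, false))].
Let psi : seq (int * (bool * bool)) := [:: (1%Z, (false, true)); ((-1)%Z, (true, false))].

Lemma qform21 F x y z : qform F [:: x; y] [:: z] =
  term F x z x z + term F x z y z + (term F y z x z + term F y z y z).
Proof. by rewrite /qform !(big_cons, big_nil, addr0). Qed.

Lemma qform22 F x y z w : qform F [:: x; y] [:: z; w] =
  term F x z x z + term F x z x w + (term F x z y z + term F x z y w)
  + (term F x w x z + term F x w x w + (term F x w y z + term F x w y w))
  + (term F y z x z + term F y z x w + (term F y z y z + term F y z y w)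
  + (term F y w x z + term F y w x w + (term F y w y z + term F y w y w))).
Proof. by rewrite /qform !(big_cons, big_nil, addr0). Qed.

(* The left-hand side is the pairing of W with F plus that of its partial
   transpose with G.  In the basis of products of Bell vectors (omega, zeta, xi,
   psi) both are diagonal; the weights are dual optimal for the linear program
   deciding decomposability among Pauli diagonal maps. *)
Lemma witness_sum (t b : C) F G :
  (forall k1 k2 l1 l2 a1 a2 c1 c2, F k1 k2 l1 l2 a1 a2 c1 c2 =
     ((1 - t) / 2 * ((k1 == l1) && (a1 == c1))%:R + t * ((k1 == a1) && (l1 == c1))%:R) *
     (if a2 == c2 then (k2 == l2)%:R / 2 else b * ((k2 == a2) && (l2 == c2))%:R)
     - G k1 k2 l1 l2 c1 c2 a1 a2) ->
  let T f := 4 * (qform F f (e false true) + qform F f (e true false)) + qform F f zeta in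
  let S f := 2 * (qform G f psi + qform G f (e false false) + qform G f (e true true)) in
  3 * qform F omega zeta + (T xi + T zeta + T psi)
  + (3 * (qform G psi psi + qform G psi xi) + (S omega + S xi + S zeta)) =
  6 * (3 - 2 * b - t - 2 * b * t).
Proof.
move=> FE T S; rewrite /T /S {T S} /omega /zeta /xi /psi /e.
(* Once [FE] is substituted all entries of [G] cancel, leaving the pairing of W with the Choi matrix
   of the map. *)
rewrite !qform21 !qform22 /term /= !FE /= !(mulr1z, mulrN1z).
by field.
Qed.

Lemma decomposable_TPi_le3 (t b : R) : decomposable (TPi t b) -> 2 * b + t + 2 * b * t <= 3.
Proof.
move=> [T [S [_ _ cT cS TS]]].
have FE k1 k2 l1 l2 a1 a2 c1 c2 : entries T k1 k2 l1 l2 a1 a2 c1 c2 =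
     ((1 - t%:C) / 2 * ((k1 == l1) && (a1 == c1))%:R + t%:C * ((k1 == a1) && (l1 == c1))%:R) *
     (if a2 == c2 then (k2 == l2)%:R / 2 else b%:C * ((k2 == a2) && (l2 == c2))%:R)
     - entries S k1 k2 l1 l2 c1 c2 a1 a2.
  pose X : 'M[C]_(2 * 2) := delta_mx (mxtens_index (o k1, o k2)) (mxtens_index (o l1, o l2)).
  have oE (x y : bool) : (o x == o y) = (x == y) by case: x; case: y.
  have := congr1 (fun M : 'M[C]_(2 * 2) =>
    M (mxtens_index (o a1, o a2)) (mxtens_index (o c1, o c2))) (TS X).
  rewrite mxE [X in _ = _ + X]mxE => h; apply/eqP; rewrite eq_sym subr_eq.
  rewrite /entries -/X -h; apply/eqP.
  (* The input is a matrix unit, so only its block at [(o k1, o l1)] is nonzero. *)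
  pose G k l := ((k == o k1) && (l == o l1))%:R *
    (if a2 == c2 then (k2 == l2)%:R / 2 else b%:C * ((k2 == a2) && (l2 == c2))%:R) : C.
  have -> : TPi t b X (mxtens_index (o a1, o a2)) (mxtens_index (o c1, o c2)) =
     ((1 - t) / 2)%:C * (o a1 == o c1)%:R * (G 0 0 + G 1 1) + t%:C * G (o a1) (o c1).
    rewrite -sum_Tmap_delta /TPi tensmapE.
    apply: eq_bigr => k _; apply: eq_bigr => l _; congr (_ * _).
    rewrite PimapE !blockmxE !mxE !mxtens_index_eq oE /G.
    move: (k == o k1) (l == o l1) => u v.
    rewrite !oE [a2 == k2]eq_sym [c2 == l2]eq_sym.
    case: ifP => _; last by case: u; case: v; case: (k2 == a2) => /=; ring.
    by case: u; case: v; case: (k2); case: (l2) => /=; ring.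
  have -> : G (o a1) (o c1) = ((k1 == a1) && (l1 == c1))%:R *
      (if a2 == c2 then (k2 == l2)%:R / 2 else b%:C * ((k2 == a2) && (l2 == c2))%:R).
    by rewrite /G !oE ![_ == k1]eq_sym ![_ == l1]eq_sym.
  have -> : G 0 0 + G 1 1 = (k1 == l1)%:R *
      (if a2 == c2 then (k2 == l2)%:R / 2 else b%:C * ((k2 == a2) && (l2 == c2))%:R).
    by rewrite /G; case: (k1); case: (l1) => /=; ring.
  rewrite oE real_complex_half rmorphB rmorph1 -mulnb natrM; ring.
have pT f g := cp_qform_ge0 f g cT; have pS f g := cp_qform_ge0 f g cS.
suff : 0 <= (6 * (3 - 2 * b - t - 2 * b * t))%:C by rewrite ler0c => ?; lra.
have -> : (6 * (3 - 2 * b - t - 2 * b * t))%:C =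
    6 * (3 - 2 * b%:C - t%:C - 2 * b%:C * t%:C).
  by rewrite !(rmorphM, rmorphB, rmorph_nat).
rewrite -(witness_sum FE) /=.
by do ?[exact: pT | exact: pS | apply: addr_ge0 | apply: mulr_ge0].
Qed.

End TensorPauliMap.

Theorem mainTheorem18 (R : realType) (t b : R) :
  0 <= t <= 1 -> 0 <= b <= 1 ->
  ((positive_map (TPi t b) /\ ~ decomposable (TPi t b)) <->
     (2 * b * t <= 1 /\ 3 < 2 * b + t + 2 * b * t))
  /\ (positive_map (TPi t b) <-> 2 * b * t <= 1).
Proof.
move=> ht hb.
have pos : positive_map (TPi t b) <-> 2 * b * t <= 1.
  by split; [exact: positive_TPi_le1|exact: positive_TPi].
split=> //; split=> [[/pos tb ndec]|[/pos tb lt3]]; split=> //.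
  by rewrite ltNge; apply/negP => le3; apply: ndec; exact: decomposable_TPi.
by move/decomposable_TPi_le3; rewrite leNgt lt3.
Qed.
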